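(* For every rule set $\Sigma$, database $\mathcal{D}$ (such that $\Sigma$ and $\mathcal{D}$ have a core model) and normal Boolean conjunctive query $q$: if $\Sigma,\mathcal{D}\models_c q$, then $\mathcal{U}\models q$ for every universal model $\mathcal{U}$ of $\Sigma$ and $\mathcal{D}$.
   Context: Fix pairwise disjoint sets of constants, nulls, variables and predicates with arities. Atoms are $p(t_1,\ldots,t_{\mathrm{ar}(p)})$; an interpretation is a set of variable-free atoms; a database is a finite set of ground (constant-only) atoms. An existential rule is $\forall\vec x,\vec y.\,\varphi[\vec x,\vec y]\to\exists\vec z.\,\psi[\vec y,\vec z]$ (body/head conjunctions of atoms, frontier $\vec y$ occurring in the body); a rule set is a finite set of rules. Homomorphisms between sets of atoms fix constants and preserve atoms; an isomorphism is a bijective homomorphism whose inverse is also a homomorphism. A model of $\Sigma$ and $\mathcal{D}$ is an interpretation containing $\mathcal{D}$ in which every homomorphism from a rule body extends to one of the rule head; a model is universal if it maps homomorphically into every model. A finite interpretation is a core if every homomorphism from it to itself is an isomorphism; a core model is a finite universal model that is a core. A normal Boolean conjunctive query (BNCQ) is $q=\exists\vec x.\,\varphi\wedge\psi$ where $\varphi$ is a conjunction of atoms (set $q^+$) over $\vec x$ and constants and $\psi$ a conjunction of negated atoms $\neg p(\vec t)$ (set $q^-$ of the atoms $p(\vec t)$) using only variables occurring in $\varphi$; it is assumed non-trivial, i.e. $q^+\cap q^-=\emptyset$. An interpretation $I$ satisfies $q$ ($I\models q$) if there is a homomorphism $h:q^+\to I$ with $h(q^-)\cap I=\emptyset$. Core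 entailment: $\Sigma,\mathcal{D}\models_c q$ if $\Sigma$ and $\mathcal{D}$ have a core model satisfying $q$. *)

(* Defs.v *)
From mathcomp Require Import all_boot all_classical.

Set Implicit Arguments.
Unset Strict Implicit.
Unset Printing Implicit Defensive.

Local Open Scope classical_set_scope.

(* No cardinality assumption is made on the carriers. *)
Record vocabulary := Vocabulary {
  constant : Type;
  null : Type;
  variable : Type;
  predicate : Type;
  ar : predicate -> nat
}.

(* Constants, nulls and variables are pairwise disjoint as distinct
   constructors of [term]. *)
Inductive term (S : vocabulary) : Type :=
| Const of constant S
| Null of null S
| Var of variable S.

Record atom (S : vocabulary) := Atom {
  head_symbol : predicate S;
  args : (ar head_symbol).-tuple (term S)
}.

Definition map_atom (S : vocabulary) (h : term S -> term S) (a : atom S) :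
  atom S := Atom (map_tuple h (args a)).

Definition terms (S : vocabulary) (A : set (atom S)) : set (term S) :=
  \bigcup_(a in A) range (tnth (args a)).

Definition vars (S : vocabulary) (A : set (atom S)) : set (variable S) :=
  [set v | terms A (Var v)].

Definition ground (S : vocabulary) (A : set (atom S)) : Prop :=
  terms A `<=` range (@Const S).

Definition null_free (S : vocabulary) (A : set (atom S)) : Prop :=
  forall n : null S, ~ terms A (Null n).

Definition interpretation (S : vocabulary) (I : set (atom S)) : Prop :=
  vars I = set0.

Definition database (S : vocabulary) (D : set (atom S)) : Prop :=
  finite_set D /\ ground D.

(* A homomorphism from A to B is a map from [terms A] to [terms B]. It is
   represented by a total function on terms whose values at nulls and variables
   outside [terms A] are irrelevant; all constants are fixed, so that it can be
   applied to atoms having constants that do not occur in A. *)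
Definition homomorphism (S : vocabulary) (A B : set (atom S))
    (h : term S -> term S) : Prop :=
  (forall c : constant S, h (Const c) = Const c) /\
  (forall a, A a -> B (map_atom h a)).

(* Bijectivity and the inverse refer to [terms A] and [terms B] only. *)
Definition isomorphism (S : vocabulary) (A B : set (atom S))
    (h : term S -> term S) : Prop :=
  [/\ homomorphism A B h,
      set_bij (terms A) (terms B) h &
      exists g, [/\ homomorphism B A g,
        (forall t, terms A t -> g (h t) = t) &
        (forall t, terms B t -> h (g t) = t)]].

(* The quantifier prefix is implicit: the frontier consists of the variables
   shared by body and head, the remaining body variables are universally
   quantified, and the remaining head variables existentially quantified. *)
Record rule (S : vocabulary) := Rule {
  body : set (atom S);
  head : set (atom S);
  body_finite : finite_set body;
  head_finite : finite_set head;
  body_null_free : null_free body;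
  head_null_free : null_free head
}.

Definition satisfies_rule (S : vocabulary) (I : set (atom S)) (r : rule S) :
    Prop :=
  forall h, homomorphism (body r) I h ->
    exists h', homomorphism (head r) I h' /\
      (forall t, terms (body r) t -> h' t = h t).

Definition model (S : vocabulary) (Sigma : set (rule S)) (D I : set (atom S)) :
    Prop :=
  [/\ interpretation I, D `<=` I &
      forall r, Sigma r -> satisfies_rule I r].

Definition universal_model (S : vocabulary) (Sigma : set (rule S))
    (D U : set (atom S)) : Prop :=
  model Sigma D U /\
  (forall M, model Sigma D M -> exists h, homomorphism U M h).

Definition core (S : vocabulary) (I : set (atom S)) : Prop :=
  [/\ interpretation I, finite_set I &
      forall h, homomorphism I I h -> isomorphism I I h].

Definition core_model (S : vocabulary) (Sigma : set (rule S))
    (D C : set (atom S)) : Prop :=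
  [/\ finite_set C, universal_model Sigma D C & core C].

Record bncq (S : vocabulary) := Bncq {
  qpos : set (atom S);
  qneg : set (atom S);
  qpos_finite : finite_set qpos;
  qneg_finite : finite_set qneg;
  qpos_null_free : null_free qpos;
  qneg_null_free : null_free qneg;
  qneg_safe : vars qneg `<=` vars qpos;
  q_nontrivial : qpos `&` qneg = set0
}.

Definition satisfies (S : vocabulary) (I : set (atom S)) (q : bncq S) : Prop :=
  exists h, homomorphism (qpos q) I h /\
    (map_atom h @` qneg q) `&` I = set0.

Definition core_entails (S : vocabulary) (Sigma : set (rule S))
    (D : set (atom S)) (q : bncq S) : Prop :=
  exists C, core_model Sigma D C /\ satisfies C q.

(* Main.v *)
Require Import Defs.
From mathcomp Require Import all_boot all_classical.

(** Let [h : C -> U] and [g : U -> C] witness that the core model C and U are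
    both universal. Since C is a core, [g \o h] has an inverse homomorphism [i],
    so any match [m] of q in C yields the match [h \o m] in U: if [h \o m] sent
    a negated atom of q into U, then [i \o g \o h \o m = m] would send it
    into C. *)

Set Implicit Arguments.
Unset Strict Implicit.

Local Open Scope classical_set_scope.

Lemma map_atom_comp (S : vocabulary) (f g : term S -> term S) (a : atom S) :
  map_atom (g \o f) a = map_atom g (map_atom f a).
Proof. by congr Atom; apply/val_inj; rewrite /= map_comp. Qed.

Lemma homomorphism_comp (S : vocabulary) (A B C : set (atom S))
    (f g : term S -> term S) :
  homomorphism B C g -> homomorphism A B f -> homomorphism A C (g \o f).
Proof.
move=> [gc gBC] [fc fAB]; split=> [c|a Aa]; first by rewrite /= fc gc.
by rewrite map_atom_comp; apply/gBC/fAB.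
Qed.

(** Agreement at the arguments of [a] is all that can be asked for: values of a homomorphism at
    nulls and variables elsewhere are arbitrary. *)
Lemma eq_map_atom (S : vocabulary) (f g : term S -> term S) (a : atom S) :
  (forall i, f (tnth (args a) i) = g (tnth (args a) i)) ->
  map_atom f a = map_atom g a.
Proof. by move=> fg; congr Atom; apply: eq_from_tnth => i; rewrite !tnth_map. Qed.

Lemma homomorphism_terms (S : vocabulary) (A B : set (atom S))
    (h : term S -> term S) (t : term S) :
  homomorphism A B h -> terms A t -> terms B (h t).
Proof.
move=> [_ hAB] [a Aa [i _ <-]]; exists (map_atom h a); first exact: hAB.
by exists i => //; rewrite /map_atom /= tnth_map.
Qed.

Theorem theorem1 (S : vocabulary) (Sigma : set (rule S)) (D : set (atom S))
    (q : bncq S) (U : set (atom S)) :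
  finite_set Sigma ->
  database D ->
  (exists C, core_model Sigma D C) ->
  core_entails Sigma D q ->
  universal_model Sigma D U ->
  satisfies U q.
Proof.
move=> _ _ _ [C [[_ [modC univC] [_ _ coreC]] [m [homm mneg]]]] [modU univU].
have [h homh] := univC U modU; have [g homg] := univU C modC.
have [_ _ [i [homi iK _]]] := coreC _ (homomorphism_comp homg homh).
exists (h \o m); split; first exact: homomorphism_comp homh homm.
rewrite -subset0 => _ [[a qa <-] Uhma].
suff : (map_atom m @` qneg q `&` C) (map_atom m a) by rewrite mneg.
split; first by exists a.
(* [iK] inverts [g \o h] only on [terms C], and a constant of [qneg q] may lie outside it; such
   constants are fixed because [i \o (g \o h)] is a homomorphism. *)
have homid : homomorphism C C (i \o (g \o h)).
  exact: homomorphism_comp homi (homomorphism_comp homg homh).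
have fix_m t : terms (qneg q) t -> (i \o g) ((h \o m) t) = m t.
  case: t => [c _|n /qneg_null_free //|v qv].
    by rewrite [in RHS]homm.1 -[RHS]homid.1 /= homm.1.
  (* By safety [v] occurs in [qpos q], so [m] sends it into [terms C], where [iK] applies. *)
  by apply/iK/(homomorphism_terms homm); apply: qneg_safe.
have -> : map_atom m a = map_atom (i \o g) (map_atom (h \o m) a).
  rewrite -map_atom_comp.
  by apply: eq_map_atom => j; rewrite -[LHS]fix_m //; exists a => //; exists j.
exact: (homomorphism_comp homi homg).2.
Qed.
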